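(* Let $q\in\mathbb C$ with $|q|\ne1$, $q\neq 0$, and let $x\in\mathbb C^*$ be such that none of $x^{\pm1},x^{\pm2}$ is an integer power of $q$. For $m\in\mathbb Z$ let $$\mathbf J_m(x,q)=\begin{pmatrix}1&C_m(x,q)&C_{m+1}(x,q)\\0&A_m(x,q)&A_{m+1}(x,q)\\0&B_m(x,q)&B_{m+1}(x,q)\end{pmatrix}.$$ Then $\mathbf J_{m+1}(x,q)=\mathbf J_m(x,q)A(x,q^m,q)$ with $$A(x,q^m,q)=\begin{pmatrix}1&0&1\\0&0&-1\\0&1&x^{-1}+x-q^{m+1}\end{pmatrix},$$ $\det\mathbf J_m(x,q)=x^{-1}-x$, and $$\mathbf J_m(x,q^{-1})=P\,\mathbf J_{-m-1}(x,q)\,P,\qquad P=\begin{pmatrix}1&0&0\\0&0&1\\0&1&0\end{pmatrix}.$$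
   Context: Notation: $(a;q)_k=\prod_{j=0}^{k-1}(1-aq^j)$. For $|q|\ne1$ and $m\in\mathbb Z$ (the series converge both for $|q|<1$ and $|q|>1$): $C_m(x,q)=\sum_{k\ge0}(-1)^k\frac{q^{k(k+1)/2+km}}{(x^{-1};q)_{k+1}(x;q)_{k+1}}$, $A_m(x,q)=\sum_{k\ge0}(-1)^k\frac{q^{k(k+1)/2+km}x^{k+m}}{(q;q)_k(x^2q;q)_k}$, $B_m(x,q)=A_m(x^{-1},q)$. *)

(* Defs.v *)
From HB Require Import structures.
From mathcomp Require Import all_boot all_order all_algebra.
From mathcomp Require Import complex.
From mathcomp Require Import all_classical all_reals all_analysis.
Set Implicit Arguments. Unset Strict Implicit. Unset Printing Implicit Defensive.
Import Order.TTheory GRing.Theory Num.Theory.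
Import numFieldNormedType.Exports.
Local Open Scope ring_scope.

(* Equip the complex numbers R[i] (R real closed) with the normed-module /
   topological structure of a numFieldType over itself (as MathComp-Analysis
   does generically for numFieldType), so that limits of series make sense. *)
Section ComplexNormed.
Variable R : rcfType.
HB.instance Definition _ := NormedModule.copy R[i] (R[i] : numFieldType)^o.
End ComplexNormed.

Definition qpoch {F : pzRingType} (a q : F) (k : nat) : F :=
  \prod_(j < k) (1 - a * q ^+ j).

Definition qexp (k : nat) (m : int) : int := ((k * k.+1)./2)%:Z + k%:Z * m.

Section Series.
Variable R : realType.
Local Notation C := R[i].

Definition Cser (m : int) (x q : C) : C :=
  limn (series (fun k : nat => (-1) ^+ k * q ^ (qexp k m)
                      / (qpoch x^-1 q k.+1 * qpoch x q k.+1))).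

Definition Aser (m : int) (x q : C) : C :=
  limn (series (fun k : nat => (-1) ^+ k * q ^ (qexp k m) * x ^ (k%:Z + m)
                      / (qpoch q q k * qpoch (x ^+ 2 * q) q k))).

Definition Bser (m : int) (x q : C) : C := Aser m x^-1 q.

Definition Jmat (m : int) (x q : C) : 'M[C]_3 :=
  \matrix_(i < 3, j < 3)
    match nat_of_ord i, nat_of_ord j with
    | 0, 0 => 1
    | 0, 1 => Cser m x q
    | 0, 2 => Cser (m + 1) x q
    | 1, 1 => Aser m x q
    | 1, 2 => Aser (m + 1) x q
    | 2, 1 => Bser m x q
    | 2, 2 => Bser (m + 1) x q
    | _, _ => 0
    end.

Definition Amat (x t q : C) : 'M[C]_3 :=
  \matrix_(i < 3, j < 3)
    match nat_of_ord i, nat_of_ord j with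
    | 0, 0 => 1
    | 0, 2 => 1
    | 1, 2 => -1
    | 2, 1 => 1
    | 2, 2 => x^-1 + x - t * q
    | _, _ => 0
    end.

Definition Pmat : 'M[C]_3 :=
  \matrix_(i < 3, j < 3)
    match nat_of_ord i, nat_of_ord j with
    | 0, 0 => 1
    | 1, 2 => 1
    | 2, 1 => 1
    | _, _ => 0
    end.
End Series.

(* Main.v *)
Require Import Defs.
From HB Require Import structures.
From mathcomp Require Import all_boot all_order all_algebra.
From mathcomp Require Import complex.
From mathcomp Require Import all_classical all_reals all_analysis.
From mathcomp Require Import ring zify.
Import Order.TTheory GRing.Theory Num.Theory.
Import numFieldNormedType.Exports.
Local Open Scope ring_scope.
Local Open Scope classical_set_scope.

(** All three series are q-hypergeometric: consecutive terms have ratio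
    [qratio c a b q k].  Multiplying a term by the denominator of this ratio
    turns the three-term combination of shifts in [m] into the previous term,
    so the recurrences follow termwise after shifting the summation index.  The
    ratio is also symmetric under [q -> 1/q], which gives the third claim
    termwise and reduces all convergence questions to [|q| < 1].  By the
    recurrence the determinant does not depend on [m]; for [|q| < 1] its value
    is read off as [m -> +oo], where [x^-m A_m] and [x^m B_m] tend to 1. *)

(** * Termwise identities: term ratios, shifts in m, inversion of q, recurrences *)

Section Terms.
Context {K : fieldType}.
Implicit Types (m : int) (x y q : K) (k : nat).

Definition Cterm m x q k : K :=
  (-1) ^+ k * q ^ (qexp k m) / (qpoch x^-1 q k.+1 * qpoch x q k.+1).

Definition Aterm m x q k : K :=
  (-1) ^+ k * q ^ (qexp k m) * x ^ (k%:Z + m)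
    / (qpoch q q k * qpoch (x ^+ 2 * q) q k).

Definition qratio (c a b q : K) k : K :=
  - (c * q ^+ k.+1) / ((1 - a * q ^+ k.+1) * (1 - b * q ^+ k.+1)).

Lemma qexpS k m : qexp k.+1 m = qexp k m + k.+1%:Z + m.
Proof.
rewrite /qexp.
have -> : ((k.+1 * k.+2)./2 = (k * k.+1)./2 + k.+1)%N.
  have -> : (k.+1 * k.+2 = k * k.+1 + k.+1.*2)%N by lia.
  by rewrite halfD odd_double andbF doubleK.
by rewrite PoszD -addn1 PoszD; ring.
Qed.

Lemma qexp0 m : qexp 0 m = 0. Proof. by rewrite /qexp mul0r. Qed.

Lemma qexp_shift k m : qexp k (m + 1) = qexp k m + k%:Z.
Proof. by rewrite /qexp; ring. Qed.

Lemma exprz_qexpS q k m : q != 0 ->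
  q ^ qexp k.+1 m = q ^ qexp k m * q ^+ k.+1 * q ^ m.
Proof.
by move=> q0; rewrite qexpS (expfzDr (_ + _) _ q0) (expfzDr (qexp k m) _ q0).
Qed.

Lemma exprz_qexp_shift q k m : q != 0 ->
  q ^ qexp k (m + 1) = q ^ qexp k m * q ^+ k.
Proof. by move=> q0; rewrite qexp_shift (expfzDr (qexp k m) _ q0). Qed.

Lemma Cterm0 m x q : Cterm m x q 0 = ((1 - x^-1) * (1 - x))^-1.
Proof. by rewrite /Cterm qexp0 /qpoch !big_ord1 !expr0 expr0z !mulr1 mul1r. Qed.

Lemma CtermS m x q k : q != 0 ->
  Cterm m x q k.+1 = Cterm m x q k * qratio (q ^ m) x^-1 x q k.
Proof.
move=> q0; rewrite /Cterm /qratio exprz_qexpS// (exprS (-1)).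
rewrite /qpoch 2![\prod_(j < k.+2) _]big_ord_recr /= !invfM; ring.
Qed.

Lemma Cterm_shift m x q k : q != 0 ->
  Cterm (m + 1) x q k = Cterm m x q k * q ^+ k.
Proof.
by move=> q0; rewrite /Cterm exprz_qexp_shift// mulrA mulrAC.
Qed.

Lemma Aterm0 m x q : Aterm m x q 0 = x ^ m.
Proof.
by rewrite /Aterm qexp0 /qpoch !big_ord0 expr0 expr0z add0r !mul1r invr1 mulr1.
Qed.

Lemma AtermS m x q k : q != 0 -> x != 0 ->
  Aterm m x q k.+1 = Aterm m x q k * qratio (q ^ m * x) 1 (x ^+ 2) q k.
Proof.
move=> q0 x0; rewrite /Aterm /qratio exprz_qexpS// !(expfzDr (Posz _) _ x0).
rewrite -!exprnP (exprS (-1)) (exprS x k) /qpoch.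
rewrite 2![\prod_(j < k.+1) _]big_ord_recr /=.
by rewrite -[x ^+ 2 * q * q ^+ k]mulrA -(exprS q k) mul1r !invfM; ring.
Qed.

Lemma Aterm_shift m x q k : q != 0 -> x != 0 ->
  Aterm (m + 1) x q k = Aterm m x q k * (q ^+ k * x).
Proof.
move=> q0 x0; rewrite /Aterm exprz_qexp_shift// addrA [x ^ (_ + 1)]expfzDr//.
by rewrite expr1z; ring.
Qed.

(** With Q = q^(k+1), each factor satisfies 1 - a/Q = -(a/Q)(1 - Q/a). The two prefactors combine to
    ab/Q^2, which turns c/Q into (c/(ab)) Q. *)
Lemma qratio_inv c a b q k : q != 0 -> a != 0 -> b != 0 ->
  qratio c a b q^-1 k = qratio (c / (a * b)) a^-1 b^-1 q k.
Proof.
move=> q0 a0 b0; rewrite /qratio exprVn; set Q := q ^+ k.+1.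
have Q0 : Q != 0 by rewrite expf_neq0.
have -> : (1 - a / Q) * (1 - b / Q) =
    a * b / Q ^+ 2 * ((1 - a^-1 * Q) * (1 - b^-1 * Q)).
  by field; rewrite Q0 a0 b0.
(* The inverse becomes an atom, so [field] only asks for q-power, a and b nonzero; vanishing
   denominators, with inverse 0, are covered too. *)
rewrite [in LHS]invfM; move: ((1 - a^-1 * Q) * _)^-1 => D.
by field; rewrite Q0 a0 b0.
Qed.

Lemma qratioC c a b q k : qratio c a b q k = qratio c b a q k.
Proof. by rewrite /qratio (mulrC (1 - a * _)). Qed.

(** Inverting q swaps the ratio parameters x^-1 and x, whose product is 1, so only q^m is
    affected. *)
Lemma Cterm_inv m x q k : q != 0 -> x != 0 ->
  Cterm m x q^-1 k = Cterm (- m) x q k.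
Proof.
move=> q0 x0; elim: k => [|k IH]; first by rewrite !Cterm0.
rewrite !CtermS ?invr_eq0// IH qratio_inv ?invr_eq0// invrK mulVf// divr1.
by rewrite qratioC exprz_inv.
Qed.

(** The parameters 1 and x^2 become 1 and x^-2, and the coefficient q^-m x is divided by x^2: this
    is the ratio for x^-1 and -m. *)
Lemma Aterm_inv m x q k : q != 0 -> x != 0 ->
  Aterm m x q^-1 k = Aterm (- m) x^-1 q k.
Proof.
move=> q0 x0; elim: k => [|k IH]; first by rewrite !Aterm0 exprz_inv opprK.
rewrite !AtermS ?invr_eq0// IH qratio_inv ?invr_eq0 ?oner_eq0 ?expf_neq0//.
rewrite invr1 exprVn mul1r exprz_inv; congr (_ * qratio _ _ _ _ _).
by field.
Qed.

(** Source of the inhomogeneous 1 in the recurrence for C: at k = 0 all shifts agree, and 2 - x^-1 -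
    x is exactly the denominator of the term. *)
Lemma Cterm_rec0 m x q : x != 0 -> 1 - x != 0 -> 1 - x^-1 != 0 ->
  Cterm m x q 0 + Cterm (m + 1 + 1) x q 0
    - (x^-1 + x) * Cterm (m + 1) x q 0 = 1.
Proof.
move=> x0 h1 h2; rewrite !Cterm0 -mulr2n -mulr_natl -mulrBl.
rewrite (_ : 2 - (x^-1 + x) = (1 - x^-1) * (1 - x)); last by field.
by rewrite mulfV// mulf_neq0.
Qed.

(** With Q = q^(k+1), the combination multiplies the term by 1 + Q^2 - (x^-1 + x)Q = (1 - xQ)(1 -
    x^-1 Q), the denominator of the ratio. *)
Lemma Cterm_recS m x q k : q != 0 -> x != 0 ->
  1 - x * q ^+ k.+1 != 0 -> 1 - x^-1 * q ^+ k.+1 != 0 ->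
  Cterm m x q k.+1 + Cterm (m + 1 + 1) x q k.+1
    - (x^-1 + x) * Cterm (m + 1) x q k.+1
  = - (q ^ m * q * Cterm (m + 1) x q k).
Proof.
move=> q0 x0 h1 h2; rewrite !Cterm_shift// CtermS// /qratio.
set c := Cterm _ _ _ _; set t := q ^ m.
have -> : q ^+ k = q ^+ k.+1 / q by rewrite exprSr mulfK.
move: (q ^+ k.+1) h1 h2 => Q h1 h2.
have h3 : x - Q != 0.
  by apply: contra_neq h2 => /subr0_eq <-; rewrite mulVf// subrr.
by field; rewrite ?q0 ?x0 ?h1 ?h3.
Qed.

Lemma Aterm_rec0 m x q : q != 0 -> x != 0 ->
  Aterm m x q 0 + Aterm (m + 1 + 1) x q 0
    - (x^-1 + x) * Aterm (m + 1) x q 0 = 0.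
Proof.
by move=> q0 x0; rewrite !Aterm_shift// expr0; field.
Qed.

(** Here a shift multiplies by xQ, and 1 + x^2 Q^2 - (x^-1 + x)xQ = (1 - Q)(1 - x^2 Q). At k = 0,
    where Q is replaced by 1, this factor vanishes. *)
Lemma Aterm_recS m x q k : q != 0 -> x != 0 ->
  1 - q ^+ k.+1 != 0 -> 1 - x ^+ 2 * q ^+ k.+1 != 0 ->
  Aterm m x q k.+1 + Aterm (m + 1 + 1) x q k.+1
    - (x^-1 + x) * Aterm (m + 1) x q k.+1
  = - (q ^ m * q * Aterm (m + 1) x q k).
Proof.
move=> q0 x0 h1 h2; rewrite !Aterm_shift// AtermS// /qratio mul1r.
set c := Aterm _ _ _ _; set t := q ^ m.
have -> : q ^+ k = q ^+ k.+1 / q by rewrite exprSr mulfK.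
move: (q ^+ k.+1) h1 h2 => Q h1 h2.
by field; rewrite ?q0 ?x0 ?h1 ?h2.
Qed.

Lemma mul_expr_neq1 y q k : q != 0 -> y != q ^ (- k%:Z) -> y * q ^+ k != 1.
Proof.
move=> q0; apply: contra_neq => h.
by rewrite -exprnN -[q ^- k]mul1r -h mulfK// expf_neq0.
Qed.

End Terms.

(** * Series over a normed field: recurrences in the limit, decay, domination *)

Section NumFieldSeries.
Context {K : numFieldType}.
Implicit Types (u v w : nat -> K) (q : K).

Lemma three_term_series u v w (s t d : K) :
  cvgn (series u) -> cvgn (series v) -> cvgn (series w) ->
  u 0%N + w 0%N - s * v 0%N = d ->
  (forall k, u k.+1 + w k.+1 - s * v k.+1 = - (t * v k)) ->
  limn (series w) = d - limn (series u) + (s - t) * limn (series v).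
Proof.
move=> cu cv cw e0 eS.
have key n : series u n.+1 + series w n.+1 - s * series v n.+1
             = d - t * series v n.
  elim: n => [|n IH].
    by rewrite /series /= !big_nat1 big_geq// mulr0 subr0.
  have -> : series u n.+2 + series w n.+2 - s * series v n.+2 =
      (series u n.+1 + series w n.+1 - s * series v n.+1)
      + (u n.+1 + w n.+1 - s * v n.+1).
    by rewrite !(seriesSr _ n.+1); ring.
  by rewrite IH eS seriesSr; ring.
have l1 : (fun n => series u n.+1 + series w n.+1 - s * series v n.+1) @ \oo
    --> limn (series u) + limn (series w) - s * limn (series v).
  apply: cvgB; first apply: cvgD.
  - by rewrite -/(_ @ _) cvg_shiftS.
  - by rewrite cvg_shiftS.
  - by apply: cvgMl_tmp; rewrite cvg_shiftS.
have l2 : (fun n => d - t * series v n) @ \oo --> d - t * limn (series v).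
  by apply: cvgB; [exact: cvg_cst|exact: cvgMl_tmp].
rewrite (funext key) in l1.
have e : limn (series u) + limn (series w) - s * limn (series v) =
    d - t * limn (series v).
  by apply: (cvg_unique (@norm_hausdorff _ K) l1 l2).
by rewrite (canRL (subrK _) (esym e)); ring.
Qed.

Lemma cvg_series_scale u v (c l : K) : series u @ \oo --> l ->
  (forall k, v k = c * u k) -> series v @ \oo --> c * l.
Proof.
move=> ul vE; rewrite (_ : series v = fun n => c * series u n).
  exact: cvgMl_tmp.
by apply/funext => n; rewrite /series /= mulr_sumr; apply: eq_bigr.
Qed.

(* The ratios tend to 0, so they are eventually at most 1/2. *)
Lemma qratio_decay q (c a b : K) u : (fun n => q ^+ n) @ \oo --> (0 : K) ->
  (forall k, u k.+1 = u k * qratio c a b q k) ->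
  exists M, forall k, `|u k| <= M * 2^-1 ^+ k.
Proof.
move=> q0 uS.
have q1 : (fun k => q ^+ k.+1) @ \oo --> (0 : K) by rewrite cvg_shiftS.
have den e : (fun k => 1 - e * q ^+ k.+1) @ \oo --> (1 : K).
  rewrite -[X in _ --> X](_ : 1 - e * 0 = 1); last by rewrite mulr0 subr0.
  by apply: cvgB; [exact: cvg_cst|exact: cvgMl_tmp].
have r0 : (fun k => qratio c a b q k) @ \oo --> (0 : K).
  rewrite -[X in _ --> X](_ : - (c * 0) / (1 * 1) = 0); last first.
    by rewrite mulr0 oppr0 mul0r.
  apply: cvgM; first by apply: cvgN; exact: cvgMl_tmp.
  by apply: cvgV; [rewrite mulr1 oner_neq0|exact: cvgM].
have h2 : (0 : K) < 2^-1 by rewrite invr_gt0.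
move/cvgrPdist_le: r0 => /(_ _ h2)[N _ rN].
(* The sum dominates each |u j| 2^j with j <= N, and from N on these numbers no longer increase. *)
exists (\sum_(0 <= j < N.+1) `|u j| * 2 ^+ j) => k.
have small j : (j <= N)%N ->
    `|u j| * 2 ^+ j <= \sum_(0 <= j < N.+1) `|u j| * 2 ^+ j.
  move=> jN; rewrite (bigD1_seq j) ?iota_uniq ?mem_index_iota//= lerDl.
  by apply: sumr_ge0 => i _; rewrite mulr_ge0// exprn_ge0.
have large j : (N <= j)%N -> `|u j| * 2 ^+ j <= `|u N| * 2 ^+ N.
  elim: j => [|j IH]; first by rewrite leqn0 => /eqP ->.
  rewrite leq_eqVlt => /predU1P[->//|Nj]; apply: le_trans (IH Nj).
  rewrite uS normrM -mulrA ler_wpM2l// exprS mulrA ler_piMl ?exprn_ge0//.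
  rewrite -ler_pdivlMr// mul1r.
  by have := rN j Nj; rewrite sub0r normrN.
have bound : `|u k| * 2 ^+ k <= \sum_(0 <= j < N.+1) `|u j| * 2 ^+ j.
  have [/small//|/ltnW/large le] := leqP k N.
  by apply: le_trans le _; apply: small.
by rewrite exprVn ler_pdivlMr ?exprn_gt0.
Qed.

Lemma geometric_partial_sum_le v M n : (forall k, `|v k| <= M * 2^-1 ^+ k) ->
  \sum_(0 <= k < n) `|v k| <= 2 * M.
Proof.
move=> vM; have M0 : 0 <= M by have := vM 0%N; rewrite mulr1; apply: le_trans.
(* The exact geometric sum is the bound that passes through the induction. *)
suff : \sum_(0 <= k < n) `|v k| <= 2 * M * (1 - 2^-1 ^+ n).
  by move/le_trans; apply; rewrite ler_piMr ?mulr_ge0// gerBl.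
elim: n => [|n IH]; first by rewrite big_geq// expr0 subrr mulr0.
rewrite big_nat_recr//=; apply: le_trans (lerD IH (vM n)) _.
by rewrite exprS le_eqVlt; apply/orP; left; apply/eqP; field.
Qed.

(** All terms but the first carry a factor [t n], so every partial sum is within |t n| 2M of 1,
    whatever its length. *)
Lemma dominated_series_cvg1 v M (t alpha : nat -> K) :
  v 0%N = 1 -> (forall k, `|v k| <= M * 2^-1 ^+ k) ->
  (forall n, `|t n| <= 1) -> t @ \oo --> (0 : K) ->
  (forall n, series (fun k => t n ^+ k * v k) @ \oo --> alpha n) ->
  alpha @ \oo --> (1 : K).
Proof.
move=> v0 vM t1 t0 ta.
have M0 : 0 <= M by have := vM 0%N; rewrite mulr1; apply: le_trans.
have tail n N :
    `|1 - series (fun k => t n ^+ k * v k) N.+1| <= `|t n| * (2 * M).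
  rewrite /series /= big_nat_recl//= expr0 mul1r v0 opprD addrA subrr sub0r.
  rewrite normrN; apply: le_trans (ler_norm_sum _ _ _) _.
  apply: le_trans (_ : `|t n| * \sum_(0 <= k < N) `|v k.+1| <= _).
    rewrite mulr_sumr; apply: ler_sum => k _; rewrite normrM ler_wpM2r//.
    by rewrite normrX exprS ler_piMr// exprn_ile1.
  rewrite ler_wpM2l//.
  apply: le_trans (geometric_partial_sum_le v M N.+1 vM).
  by rewrite [leRHS]big_nat_recl//= lerDr.
apply/cvgrPdist_le => e e0.
have e2 : 0 < e / 2 by rewrite divr_gt0.
(* The added 1 keeps the divisor positive when M = 0. *)
have e3 : 0 < e / 2 / (2 * M + 1).
  by rewrite divr_gt0// ltr_wpDl// mulr_ge0.
move/cvgrPdist_le: t0 => /(_ _ e3)[N _ tN].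
exists N => // n Nn /=.
(* The length p may depend on n, since the bound [tail] is uniform in it. *)
move: (ta n) => /cvgrPdist_le/(_ _ e2)[p _ ap].
rewrite (_ : 1 - alpha n = (1 - series (fun k => t n ^+ k * v k) p.+1)
  - (alpha n - series (fun k => t n ^+ k * v k) p.+1)); last by ring.
apply: le_trans (ler_normB _ _) _; rewrite (splitr e); apply: lerD; last first.
  by apply: ap => /=.
apply: le_trans (tail n p) _.
have := tN n Nn; rewrite sub0r normrN ler_pdivlMr ?ltr_wpDl ?mulr_ge0//.
by apply: le_trans; rewrite ler_wpM2l// lerDl.
Qed.

(** Rewriting d in the normalized sequences x^-n A_n and x^n B_n leaves the factors x^-1 and x,
    which survive in the limit. *)
Lemma casoratian_eq (A B : nat -> K) (x d : K) : x != 0 ->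
  (fun n => x ^- n * A n) @ \oo --> (1 : K) ->
  (fun n => x ^+ n * B n) @ \oo --> (1 : K) ->
  (forall n, A n * B n.+1 - A n.+1 * B n = d) -> d = x^-1 - x.
Proof.
move=> x0 hA hB hd.
have hA1 : (fun n => x ^- n.+1 * A n.+1) @ \oo --> (1 : K).
  by rewrite (cvg_shiftS (fun n => x ^- n * A n)).
have hB1 : (fun n => x ^+ n.+1 * B n.+1) @ \oo --> (1 : K).
  by rewrite (cvg_shiftS (fun n => x ^+ n * B n)).
have l : (fun n => x^-1 * ((x ^- n * A n) * (x ^+ n.+1 * B n.+1))
    - x * ((x ^- n.+1 * A n.+1) * (x ^+ n * B n))) @ \oo
    --> x^-1 * (1 * 1) - x * (1 * 1).
  by apply: cvgB; apply: cvgMl_tmp; exact: cvgM.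
rewrite (_ : (fun n => _) = cst d) in l; last first.
  apply/funext => n /=; rewrite -(hd n) !exprS.
  have xn : x ^+ n != 0 by rewrite expf_neq0.
  by field; rewrite xn x0.
have <- : x^-1 * (1 * 1) - x * (1 * 1) = d.
  by apply: (cvg_unique (@norm_hausdorff _ K) l); exact: cvg_cst.
by rewrite !mulr1.
Qed.

End NumFieldSeries.

(** * Convergence in [R[i]] reduced to real convergence *)

Section ComplexSeries.
Variable R : realType.
Local Notation C := R[i].
Local Notation normc := ComplexField.Normc.normc.

Lemma normc_le_ReIm (z : C) : normc z <= `|complex.Re z| + `|complex.Im z|.
Proof.
case: z => a b /=.
rewrite -[leRHS]ger0_norm ?addr_ge0// -sqrtr_sqr ler_wsqrtr//.
rewrite sqrrD !real_normK ?num_real// lerD2r lerDl.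
by rewrite mulrn_wge0 ?mulr_ge0.
Qed.

Lemma norm_Re_le (z : C) : `|complex.Re z| <= normc z.
Proof. by rewrite -lecR; exact: normc_ge_Re. Qed.

Lemma norm_Im_le (z : C) : `|complex.Im z| <= normc z.
Proof.
by case: z => a b /=; rewrite -sqrtr_sqr ler_wsqrtr// lerDr sqr_ge0.
Qed.

Lemma cvg_normc (z : nat -> C) (l : C) (r : nat -> R) :
  (forall n, normc (l - z n) <= r n) -> r @ \oo --> (0 : R) ->
  z @ \oo --> l.
Proof.
move=> zr r0; apply: (iffRL (@cvgrPdist_le C C nat \oo _ z l)) => -[e e'].
(* Positivity in [R[i]] forces a zero imaginary part, so the tolerance is a real number. *)
rewrite ltcE /= => /andP[/eqP -> e0].
move/cvgrPdist_le: r0 => /(_ _ e0)[N _ rN]; exists N => // n Nn /=.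
rewrite (_ : `|l - z n| = (normc (l - z n))%:C%C)// lecR.
apply: le_trans (zr n) _; apply: le_trans (rN n Nn).
by rewrite sub0r normrN ler_norm.
Qed.

Lemma cvg_exprC (q : C) : `|q| < 1 -> (fun n => q ^+ n) @ \oo --> (0 : C).
Proof.
move=> q1; apply: (@cvg_normc _ _ (fun n => normc q ^+ n)) => [n|].
  by rewrite -lecR rmorphXn -[leLHS]/(`|0 - q ^+ n|) sub0r normrN normrX.
apply: cvg_expr; rewrite ger0_norm; first by rewrite -ltcR.
by rewrite -lecR; exact: (normr_ge0 q).
Qed.

(** Real and imaginary parts converge absolutely by comparison with a real geometric series; the
    bound at k = 0 shows that M is real. *)
Lemma cvg_series_geometricC (u : nat -> C) (M : C) :
  (forall k, `|u k| <= M * 2^-1 ^+ k) -> cvgn (series u).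
Proof.
case: M => M M' uM.
have M'0 : M' = 0.
  by move: (uM 0%N); rewrite expr0 mulr1 lecE /= => /andP[/eqP].
have nu k : normc (u k) <= M * 2^-1 ^+ k.
  rewrite -lecR rmorphM rmorphXn fmorphV rmorph_nat /=.
  by have := uM k; rewrite M'0.
have M0 : 0 <= M.
  have := nu 0%N; rewrite expr0 mulr1; apply: le_trans.
  by rewrite -lecR; exact: (normr_ge0 (u 0%N)).
have part (f : C -> R) : (forall z, `|f z| <= normc z) ->
    cvgn (series (fun k => f (u k))).
  move=> fz; apply: normed_cvg.
  apply: (@series_le_cvg R _ (geometric M 2^-1)) => [n|n|n|] /=.
  - by [].
  - by rewrite mulr_ge0.
  - exact: le_trans (fz _) (nu n).
  - by apply: is_cvg_geometric_series; rewrite ger0_norm// invf_lt1// ltr1n.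
have cRe := part _ norm_Re_le; have cIm := part _ norm_Im_le.
set a := limn _ in cRe; set b := limn _ in cIm.
apply/cvg_ex; exists (a +i* b)%C.
have reS n : complex.Re (series u n) = series (fun k => complex.Re (u k)) n.
  by rewrite /series /= raddf_sum.
have imS n : complex.Im (series u n) = series (fun k => complex.Im (u k)) n.
  by rewrite /series /= raddf_sum.
apply: (@cvg_normc _ _ (fun n => `|a - series (fun k => complex.Re (u k)) n|
  + `|b - series (fun k => complex.Im (u k)) n|)) => [n|].
  by rewrite -reS -imS; apply: le_trans (normc_le_ReIm _) _; case: (series u n).
rewrite -[X in _ --> X]addr0; apply: cvgD; apply/norm_cvg0P.
  rewrite -[X in _ --> X](subrr a); apply: cvgB => //; exact: cvg_cst.
rewrite -[X in _ --> X](subrr b); apply: cvgB => //; exact: cvg_cst.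
Qed.

End ComplexSeries.

(** * Convergence, inversion, recurrences and asymptotics of the sums *)

Section Solutions.
Context {R : realType}.
Local Notation C := R[i].
Implicit Types (m : int) (x q : C).

Lemma norm_neq1_inv q : q != 0 -> `|q| != 1 -> `|q| < 1 \/ `|q^-1| < 1.
Proof.
move=> q0 q1; case: (real_ltgtP (normr_real q) (@real1 C)) => h.
- by left.
- by right; rewrite normfV invf_lt1 ?normr_gt0.
- by rewrite h eqxx in q1.
Qed.

Lemma decay_Aterm m x q : q != 0 -> x != 0 -> `|q| < 1 ->
  exists M, forall k, `|Aterm m x q k| <= M * 2^-1 ^+ k.
Proof.
move=> q0 x0 q1.
apply: (@qratio_decay C q (q ^ m * x) 1 (x ^+ 2)); first exact: cvg_exprC.
by move=> k; exact: AtermS.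
Qed.

Lemma decay_Cterm m x q : q != 0 -> `|q| < 1 ->
  exists M, forall k, `|Cterm m x q k| <= M * 2^-1 ^+ k.
Proof.
move=> q0 q1.
apply: (@qratio_decay C q (q ^ m) x^-1 x); first exact: cvg_exprC.
by move=> k; exact: CtermS.
Qed.

Lemma cvg_Aterm m x q : q != 0 -> `|q| != 1 -> x != 0 ->
  cvgn (series (Aterm m x q)).
Proof.
move=> q0 q1 x0; have [h|h] := norm_neq1_inv q q0 q1.
  by have [M] := decay_Aterm m x q q0 x0 h; exact: cvg_series_geometricC.
(* For |q| > 1 the same terms are read in base q^-1, where the decay bound applies. *)
have E : Aterm m x q = Aterm (- m) x^-1 q^-1.
  by apply/funext => k; rewrite Aterm_inv ?invr_eq0// opprK invrK.
have [|||M] := decay_Aterm (- m) x^-1 q^-1; rewrite ?invr_eq0// -E.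
exact: cvg_series_geometricC.
Qed.

Lemma cvg_Cterm m x q : q != 0 -> `|q| != 1 -> x != 0 ->
  cvgn (series (Cterm m x q)).
Proof.
move=> q0 q1 x0; have [h|h] := norm_neq1_inv q q0 q1.
  by have [M] := decay_Cterm m x q q0 h; exact: cvg_series_geometricC.
have E : Cterm m x q = Cterm (- m) x q^-1.
  by apply/funext => k; rewrite Cterm_inv// opprK.
have [||M] := decay_Cterm (- m) x q^-1; rewrite ?invr_eq0// -E.
exact: cvg_series_geometricC.
Qed.

Lemma Aser_inv m x q : q != 0 -> x != 0 -> Aser m x q^-1 = Aser (- m) x^-1 q.
Proof.
move=> q0 x0; congr (limn (series _)).
by apply/funext => k; exact: Aterm_inv.
Qed.

Lemma Cser_inv m x q : q != 0 -> x != 0 -> Cser m x q^-1 = Cser (- m) x q.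
Proof.
move=> q0 x0; congr (limn (series _)).
by apply/funext => k; exact: Cterm_inv.
Qed.

Lemma expr_neq1 q k : `|q| != 1 -> q ^+ k.+1 != 1.
Proof.
apply: contra_neq => h; apply/eqP.
by rewrite -(@pexpr_eq1 _ _ k.+1)// -normrX h normr1.
Qed.

Lemma Aser_rec m x q : q != 0 -> `|q| != 1 -> x != 0 ->
  (forall k, x ^+ 2 * q ^+ k.+1 != 1) ->
  Aser (m + 1 + 1) x q =
    - Aser m x q + (x^-1 + x - q ^ m * q) * Aser (m + 1) x q.
Proof.
move=> q0 q1 x0 hx; rewrite -[- Aser m x q]add0r.
apply: (@three_term_series C (Aterm m x q) (Aterm (m + 1) x q)
  (Aterm (m + 1 + 1) x q) (x^-1 + x) (q ^ m * q) 0).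
- exact: cvg_Aterm.
- exact: cvg_Aterm.
- exact: cvg_Aterm.
- exact: Aterm_rec0.
- move=> k; apply: Aterm_recS => //; rewrite subr_eq0 eq_sym//.
  exact: expr_neq1.
Qed.

Lemma Cser_rec m x q : q != 0 -> `|q| != 1 -> x != 0 ->
  (forall k, x * q ^+ k != 1) -> (forall k, x^-1 * q ^+ k != 1) ->
  Cser (m + 1 + 1) x q =
    1 - Cser m x q + (x^-1 + x - q ^ m * q) * Cser (m + 1) x q.
Proof.
move=> q0 q1 x0 h1 h2.
apply: (@three_term_series C (Cterm m x q) (Cterm (m + 1) x q)
  (Cterm (m + 1 + 1) x q) (x^-1 + x) (q ^ m * q) 1).
- exact: cvg_Cterm.
- exact: cvg_Cterm.
- exact: cvg_Cterm.
- apply: Cterm_rec0 => //; rewrite subr_eq0 eq_sym.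
    by have := h1 0%N; rewrite mulr1.
  by have := h2 0%N; rewrite mulr1.
- by move=> k; apply: Cterm_recS => //; rewrite subr_eq0 eq_sym.
Qed.

Lemma Aterm_natE (n : nat) x q k : q != 0 -> x != 0 ->
  Aterm n x q k = x ^+ n * ((q ^+ n) ^+ k * Aterm 0 x q k).
Proof.
move=> q0 x0; elim: n => [|n IH]; first by rewrite !expr0 expr1n !mul1r.
rewrite -addn1 PoszD Aterm_shift// IH addn1 !exprSr exprMn.
by ring.
Qed.

(** The terms of x^-n A_n are (q^n)^k times those of A_0, whose first term is 1, so domination
    applies with q^n tending to 0. *)
Lemma Aser_asymp x q : q != 0 -> `|q| < 1 -> x != 0 ->
  (fun n : nat => x ^- n * Aser n x q) @ \oo --> (1 : C).
Proof.
move=> q0 q1 x0.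
have [M hM] := decay_Aterm 0 x q q0 x0 q1.
apply: (@dominated_series_cvg1 C (Aterm 0 x q) M (fun n => q ^+ n)) => //.
- by rewrite Aterm0 expr0z.
- by move=> n; rewrite normrX exprn_ile1// ltW.
- exact: cvg_exprC.
move=> n.
have cA : series (Aterm n x q) @ \oo --> Aser n x q.
  by apply: cvg_Aterm; rewrite // lt_eqF.
apply: (@cvg_series_scale C (Aterm n x q) _ (x ^- n) _ cA) => k.
by rewrite [in RHS]Aterm_natE// mulKf// expf_neq0.
Qed.

End Solutions.

(** * The determinant and the final theorem *)

Section Casoratian.
Context {R : realType}.
Local Notation C := R[i].
Implicit Types (m : int) (x q : C).

(** The lower right minor of [Jmat], with [Bser] unfolded; it is the full determinant because the
    first column is a unit vector. *)
Definition casoratian m x q : C :=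
  Aser m x q * Aser (m + 1) x^-1 q - Aser (m + 1) x q * Aser m x^-1 q.

Lemma int_shift_const {T : Type} (f : int -> T) :
  (forall m, f (m + 1) = f m) -> forall m, f m = f 0.
Proof.
move=> fS; elim=> [//|n IH|n IH]; first by rewrite -addn1 PoszD fS.
by rewrite -IH -fS; congr f; lia.
Qed.

(** Both solutions obey one recurrence, as x^-1 + x is symmetric, and its transfer matrix has
    determinant 1. *)
Lemma casoratian_shift m x q : q != 0 -> `|q| != 1 -> x != 0 ->
  (forall k, x ^+ 2 * q ^+ k.+1 != 1) ->
  (forall k, x^-1 ^+ 2 * q ^+ k.+1 != 1) ->
  casoratian (m + 1) x q = casoratian m x q.
Proof.
move=> q0 q1 x0 h1 h2; rewrite /casoratian.
rewrite (Aser_rec m x q)// (Aser_rec m x^-1 q) ?invr_eq0// invrK.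
move: (Aser m x q) (Aser (m + 1) x q) (Aser m _ q) (Aser (m + 1) _ q).
by move=> A0 A1 B0 B1; ring.
Qed.

Lemma casoratianE m x q : q != 0 -> `|q| != 1 -> x != 0 ->
  (forall e : int, x ^+ 2 != q ^ e) -> casoratian m x q = x^-1 - x.
Proof.
have small (p : C) n (y : C) : p != 0 -> `|p| < 1 -> y != 0 ->
    (forall e : int, y ^+ 2 != p ^ e) -> casoratian n y p = y^-1 - y.
  move=> p0 p1 y0 hy.
  have p1' : `|p| != 1 by rewrite lt_eqF.
  have cst k : casoratian k y p = casoratian 0 y p.
    apply: (int_shift_const (fun k => casoratian k y p)) => {}k.
    apply: casoratian_shift => // j; apply: mul_expr_neq1 => //.
    apply: contra (hy j.+1) => /eqP h.
    by rewrite -exprnP -[y ^+ 2]invrK -exprVn h -exprnN invrK.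
  rewrite cst; apply: (@casoratian_eq C (fun k => Aser k y p)
    (fun k => Aser k y^-1 p) y) => //.
  - exact: Aser_asymp.
  - have := Aser_asymp y^-1 p p0 p1; rewrite invr_eq0 => /(_ y0).
    by under eq_fun do rewrite exprVn invrK.
  - by move=> k; rewrite -(cst k) /casoratian -PoszD addn1.
move=> q0 q1 x0 hx; have [h|h] := norm_neq1_inv q q0 q1; first exact: small.
have hx' e : x ^+ 2 != q^-1 ^ e by rewrite exprz_inv.
have q'0 : q^-1 != 0 by rewrite invr_eq0.
have x'0 : x^-1 != 0 by rewrite invr_eq0.
(* Inverting q exchanges A with B and sends the pair m, m+1 to -m, -m-1; the two resulting signs
   cancel. *)
apply: etrans (small q^-1 (- m - 1) x q'0 h x0 hx').
have inv n : Aser (- n) x q^-1 = Aser n x^-1 q.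
  by rewrite (Aser_inv (- n) x q q0 x0) opprK.
have inv' n : Aser (- n) x^-1 q^-1 = Aser n x q.
  by rewrite (Aser_inv (- n) x^-1 q q0 x'0) opprK invrK.
rewrite /casoratian subrK -opprD !inv !inv'.
move: (Aser m x q) (Aser (m + 1) x q) (Aser m _ q) (Aser (m + 1) _ q).
by move=> A0 A1 B0 B1; ring.
Qed.

End Casoratian.

Theorem theorem3p1 (R : realType) (q x : R[i]) (m : int) :
  q != 0 -> `|q| != 1 -> x != 0 ->
  (forall e : int, [/\ x != q ^ e, x^-1 != q ^ e, x ^+ 2 != q ^ e & x ^- 2 != q ^ e]) ->
  [/\ Jmat (m + 1) x q = Jmat m x q *m Amat x (q ^ m) q,
      \det (Jmat m x q) = x^-1 - x
    & Jmat m x q^-1 = Pmat R *m Jmat (- m - 1) x q *m Pmat R].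
Proof.
move=> q0 q1 x0 H.
(* Negative exponents in the hypothesis say that the denominator factors involving x do not
   vanish. *)
have hx k : x * q ^+ k != 1 by apply: mul_expr_neq1 => //; case: (H (- k%:Z)).
have hVx k : x^-1 * q ^+ k != 1.
  by apply: mul_expr_neq1 => //; case: (H (- k%:Z)).
have hx2 k : x ^+ 2 * q ^+ k.+1 != 1.
  by apply: mul_expr_neq1 => //; case: (H (- k.+1%:Z)).
have hVx2 k : x^-1 ^+ 2 * q ^+ k.+1 != 1.
  by rewrite exprVn; apply: mul_expr_neq1 => //; case: (H (- k.+1%:Z)).
split.
- apply/matrixP => i j; rewrite !mxE !big_ord_recl big_ord0 !mxE /=.
  case: i => -[|[|[|i]]] hi //; case: j => -[|[|[|j]]] hj //=.
  all: rewrite ?mul0r ?mulr0 ?mul1r ?mulr1 ?add0r ?addr0//.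
  (* Only the third column remains, one recurrence per row. *)
  + rewrite (Cser_rec m x q)//.
    by move: (Cser m x q) (Cser (m + 1) x q) => C0 C1; ring.
  + rewrite (Aser_rec m x q)//.
    by move: (Aser m x q) (Aser (m + 1) x q) => A0 A1; ring.
  + rewrite /Bser (Aser_rec m x^-1 q) ?invr_eq0// invrK.
    by move: (Aser m _ q) (Aser (m + 1) _ q) => B0 B1; ring.
- rewrite (expand_det_col _ ord0) !big_ord_recl big_ord0 /cofactor !mxE /=.
  rewrite !mul0r !addr0 expr0 !mul1r (expand_det_row _ ord0).
  rewrite !big_ord_recl big_ord0 /cofactor !det_mx11 !mxE /=.
  rewrite addr0 expr0 mul1r expr1 mulN1r mulrN.
  by apply: casoratianE => // e; case: (H e).
(* Inversion negates indices, which swaps the last two columns, and exchanges A with B, which swaps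
   the last two rows. *)
- have eC n : Cser n x q^-1 = Cser (- n) x q by exact: Cser_inv.
  have eA n : Aser n x q^-1 = Bser (- n) x q by exact: Aser_inv.
  have eB n : Bser n x q^-1 = Aser (- n) x q.
    by rewrite -[x in RHS]invrK; apply: Aser_inv; rewrite ?invr_eq0.
  apply/matrixP => i j; rewrite !mxE !big_ord_recl big_ord0 !mxE /=.
  rewrite !big_ord_recl !big_ord0 !mxE /= subrK !eC !eA !eB opprD.
  move: (Cser (- m) x q) (Cser (- m - 1) x q) (Aser (- m) x q) => C0 C1 A0.
  move: (Aser (- m - 1) x q) (Bser (- m) x q) (Bser (- m - 1) x q) => A1 B0 B1.
  case: i => -[|[|[|i]]] hi //; case: j => -[|[|[|j]]] hj //=.
  all: by rewrite !(mul0r, mulr0, mul1r, mulr1, add0r, addr0).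
Qed.
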